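(* Fix $T\in\mathcal{S}'(\mathbb{R})$ and a family of kernels $\mathcal{K}\subset\mathcal{S}(\mathbb{R})$ such that, for every $\varphi\in\mathcal{K}$, the pair $(T,\varphi)$ has ${}^{(\varphi)}\phi(0)\ne0$, ${}^{(\varphi)}\kappa_2>0$, and ${}^{(\varphi)}K$ is $C^3$ in a neighbourhood of the origin. Suppose that for some $T_0>0$, $$c_0:=\inf_{\varphi\in\mathcal{K}}{}^{(\varphi)}\kappa_2>0,\qquad \overline{M}:=\sup_{\varphi\in\mathcal{K}}\ \sup_{|u|\le T_0/\sqrt{c_0}}\bigl|{}^{(\varphi)}K^{(3)}(u)\bigr|<\infty.$$ Let $Z_n^{(\varphi)}=\bigl(S_n-n\,{}^{(\varphi)}\kappa_1\bigr)/\sqrt{n\,{}^{(\varphi)}\kappa_2}$ denote the sum $S_n$ of $n$ i.i.d. generalised random variables with pair $(T,\varphi)$, normalised by the first two weak cumulants of $(T,\varphi)$. Then $$\sup_{\varphi\in\mathcal{K}}\ \sup_{|t|\le T_0}\Bigl|{}^{(\varphi)}\phi_{Z_n^{(\varphi)}}(t)-e^{-t^2/2}\Bigr|=O\!\left(\frac1{\sqrt n}\right),$$ with the implied constant depending only on $T_0$, $c_0$ and $\overline{M}$.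
   Context: $\mathcal{S}$ and $\mathcal{S}'$ denote Schwartz functions and tempered distributions. The weak characteristic function of a pair $(T,\varphi)$ is ${}^{(\varphi)}\phi(t):=\langle T,e^{itx}\varphi(x)\rangle$; where it does not vanish near $0$, the weak cumulant generating function is ${}^{(\varphi)}K(t):=\log{}^{(\varphi)}\phi(t)$, and the weak cumulants are ${}^{(\varphi)}\kappa_n:=i^{-n}\frac{d^n}{dt^n}{}^{(\varphi)}K(t)\big|_{t=0}$ ($n\ge1$), with ${}^{(\varphi)}\kappa_1\in\mathbb{R}$. I.i.d. means that the joint representation of the $n$ variables is the $n$-fold tensor product pair $(T^{\otimes n},\varphi^{\otimes n})$, so that ${}^{(\varphi)}\phi_{S_n}(t)={}^{(\varphi)}\phi(t)^n$; the weak characteristic function of $Z_n^{(\varphi)}$ is $${}^{(\varphi)}\phi_{Z_n^{(\varphi)}}(t)=\exp\!\left(-it\frac{n\,{}^{(\varphi)}\kappa_1}{\sqrt{n\,{}^{(\varphi)}\kappa_2}}\right)\left({}^{(\varphi)}\phi\!\left(\frac{t}{\sqrt{n\,{}^{(\varphi)}\kappa_2}}\right)\right)^{n}.$$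
   Formalization: The total mass φ(0)=⟨T,φ⟩ is assumed equal to 1 (with K(0)=0), not merely nonzero: at t=0 the claim reads |φ(0)^n−1|=O(1/√n), which fails for every φ(0)≠1 (e.g. twice a Gaussian density). *)

(* Defs.v *)
From Stdlib Require Import Reals List.
From Coquelicot Require Import Coquelicot.
Open Scope R_scope.

Definition Cexp (z : C) : C :=
  (exp (Re z) * cos (Im z), exp (Re z) * sin (Im z)).

(* Derivatives of complex-valued functions of a real variable, componentwise.
   [Derive_n] is total, hence the separate existence predicate; Coquelicot's
   [ex_derive_n f k] only speaks about the last differentiation, hence the
   quantification over all orders up to n. *)
Definition CDerive_n (f : R -> C) (n : nat) (x : R) : C :=
  (Derive_n (fun u => Re (f u)) n x, Derive_n (fun u => Im (f u)) n x).

Definition ex_CDerive_upto (f : R -> C) (n : nat) (x : R) : Prop :=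
  forall k, (k <= n)%nat ->
    ex_derive_n (fun u => Re (f u)) k x /\ ex_derive_n (fun u => Im (f u)) k x.

Definition C3_near_0 (f : R -> C) : Prop :=
  exists eps, 0 < eps /\
    forall u, Rabs u < eps ->
      ex_CDerive_upto f 3 u /\ continuous (CDerive_n f 3) u.

Definition schwartz_seminorm (m k : nat) (f : R -> C) : Rbar :=
  Lub_Rbar (fun y => exists x, y = Rabs x ^ m * Cmod (CDerive_n f k x)).

Definition schwartz (f : R -> C) : Prop :=
  (forall n x, ex_CDerive_upto f n x) /\
  (forall m k, is_finite (schwartz_seminorm m k f)).

(* A tempered distribution is a functional on Schwartz functions: it is encoded
   by a function on all of [R -> C], about whose values outside the Schwartz
   space nothing is assumed. *)
Definition tempered (T : (R -> C) -> C) : Prop :=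
  (forall f g, schwartz f -> schwartz g ->
     T (fun x => Cplus (f x) (g x)) = Cplus (T f) (T g)) /\
  (forall a f, schwartz f -> T (fun x => Cmult a (f x)) = Cmult a (T f)) /\
  (exists (A : R) (N : nat), forall f, schwartz f ->
     Cmod (T f) <=
       A * sum_f_R0 (fun m => sum_f_R0 (fun k =>
             real (schwartz_seminorm m k f)) N) N).

Definition modulate (t : R) (f : R -> C) : R -> C :=
  fun x => Cmult (Cexp (0, t * x)) (f x).

Definition weak_cf (T : (R -> C) -> C) (phi : R -> C) (t : R) : C :=
  T (modulate t phi).

(* K = log (weak_cf T phi) on (-rho, rho): the continuous branch of the
   logarithm that vanishes at 0, where weak_cf T phi is 1.  The equation
   forces weak_cf T phi not to vanish on (-rho, rho). *)
Definition is_weak_cgf (T : (R -> C) -> C) (phi : R -> C)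
    (rho : R) (K : R -> C) : Prop :=
  K 0 = RtoC 0 /\
  forall u, Rabs u < rho ->
    continuous K u /\ Cexp (K u) = weak_cf T phi u.

Definition weak_cumulant (K : R -> C) (n : nat) : C :=
  Cdiv (CDerive_n K n 0) (Cpow Ci n).

(* The value of T (x) ... (x) T on the pure tensor of the functions in fs. *)
Definition tensor_pairing (T : (R -> C) -> C) (fs : list (R -> C)) : C :=
  fold_right (fun f z => Cmult (T f) z) (RtoC 1) fs.

(* S_n = X_1 + ... + X_n for the pair of n-fold tensor powers of T and phi:
   exp (i t (x_1 + ... + x_n)) phi(x_1) ... phi(x_n) is the pure tensor of n
   copies of exp (i t x) phi(x). *)
Definition weak_cf_sum (T : (R -> C) -> C) (phi : R -> C)
    (n : nat) (t : R) : C :=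
  tensor_pairing T (repeat (modulate t phi) n).

Definition weak_cf_Z (T : (R -> C) -> C) (phi : R -> C) (K : R -> C)
    (n : nat) (t : R) : C :=
  let kappa1 := weak_cumulant K 1 in
  let s := sqrt (INR n * Re (weak_cumulant K 2)) in
  Cmult
    (Cexp (Copp (Cmult Ci (Cmult (RtoC t)
       (Cdiv (Cmult (RtoC (INR n)) kappa1) (RtoC s))))))
    (weak_cf_sum T phi n (t / s)).

(* Standing assumptions on one pair (T, phi) with weak cumulant generating
   function K.  The pair represents a generalised random variable, so its total
   mass <T, phi> = weak_cf T phi 0 is not merely nonzero but 1; without this
   the weak characteristic function of Z_n at 0 would be <T, phi>^n. *)
Record admissible (T : (R -> C) -> C) (phi K : R -> C) : Prop := {
  adm_schwartz : schwartz phi;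
  adm_mass : weak_cf T phi 0 = RtoC 1;
  adm_C3 : C3_near_0 K;
  adm_kappa1_real : Im (weak_cumulant K 1) = 0;
  adm_kappa2_real : Im (weak_cumulant K 2) = 0;
  adm_kappa2_pos : 0 < Re (weak_cumulant K 2)
}.

(* Main.v *)
(** On [|u| <= T0 / sqrt c0] the cumulant generating function differs from its
    quadratic Taylor polynomial [i kappa1 u - kappa2 u^2 / 2] by at most a
    multiple of [M |u|^3].  At [u = t / sqrt (n kappa2)] the linear term of
    [n K u] is removed by the centring and the quadratic one is [- t^2 / 2], so
    the weak characteristic function of Z_n is [exp (- t^2 / 2 + r)] with
    [r = O (n |u|^3) = O (1 / sqrt n)] uniformly over the kernels. *)
Require Import Defs.
From Stdlib Require Import Reals List Lra Lia.
From Coquelicot Require Import Coquelicot.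
Open Scope R_scope.

(** * Taylor remainders of real functions *)

(** The mean value theorem gives [g x = g' c * x] with [c] between 0 and [x]. The factor
    [1 / (k + 1)] that integration would yield is given up, which only affects constants. *)
Lemma Rabs_le_pow_of_derive (g g' : R -> R) (a C : R) (k : nat) :
  0 <= C -> g 0 = 0 ->
  (forall x, Rabs x <= a -> is_derive g x (g' x)) ->
  (forall x, Rabs x <= a -> Rabs (g' x) <= C * Rabs x ^ k) ->
  forall x, Rabs x <= a -> Rabs (g x) <= C * Rabs x ^ S k.
Proof.
  intros HC g0 Hd Hb x Hx.
  assert (between : forall y, Rmin 0 x <= y <= Rmax 0 x -> Rabs y <= Rabs x).
  { intros y. unfold Rmin, Rmax. destruct (Rle_dec 0 x); intros Hy.
    - rewrite !Rabs_pos_eq; lra.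
    - rewrite !Rabs_left1; lra. }
  destruct (MVT_gen g 0 x g') as [c [Hc E]].
  - intros y Hy. apply Hd. apply Rle_trans with (Rabs x); auto. apply between; lra.
  - intros y Hy. apply continuity_pt_filterlim.
    apply (ex_derive_continuous g). exists (g' y). apply Hd.
    apply Rle_trans with (Rabs x); auto.
  - apply between in Hc.
    replace (g x) with (g' c * x) by lra.
    rewrite Rabs_mult.
    replace (C * Rabs x ^ S k) with (C * Rabs x ^ k * Rabs x) by (simpl; ring).
    apply Rmult_le_compat_r; [apply Rabs_pos|].
    eapply Rle_trans; [apply Hb; lra|].
    apply Rmult_le_compat_l; auto.
    apply pow_incr; split; [apply Rabs_pos | auto].
Qed.

Lemma is_derive_Rminus (f g : R -> R) (x df dg l : R) :
  is_derive f x df -> is_derive g x dg -> df - dg = l ->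
  is_derive (fun u => f u - g u) x l.
Proof.
  intros Hf Hg <-. exact (is_derive_minus f g x df dg Hf Hg).
Qed.

(** Three uses of [Rabs_le_pow_of_derive], descending from the bound on the third derivative; each
    raises the power of [Rabs x] by one. The usual factor 1/6 is lost. *)
Lemma taylor2_remainder (f : R -> R) (a C : R) :
  0 <= C -> f 0 = 0 ->
  (forall x, Rabs x <= a -> forall k, (k <= 3)%nat -> ex_derive_n f k x) ->
  (forall x, Rabs x <= a -> Rabs (Derive_n f 3 x) <= C) ->
  forall x, Rabs x <= a ->
    Rabs (f x - Derive_n f 1 0 * x - Derive_n f 2 0 * x ^ 2 / 2)
      <= C * Rabs x ^ 3.
Proof.
  intros HC f0 Hex Hb.
  assert (D : forall k x, (k < 3)%nat -> Rabs x <= a ->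
            is_derive (Derive_n f k) x (Derive_n f (S k) x)).
  { intros k x Hk Hx. apply Derive_correct. apply (Hex x Hx (S k)). lia. }
  assert (B2 : forall x, Rabs x <= a ->
            Rabs (Derive_n f 2 x - Derive_n f 2 0) <= C * Rabs x ^ 1).
  { apply Rabs_le_pow_of_derive with (g' := Derive_n f 3); auto; [ring| |].
    - intros x Hx.
      apply is_derive_Rminus with (Derive_n f 3 x) 0; [apply D; auto | | ring].
      apply (is_derive_const (V := R_NormedModule)).
    - intros x Hx. simpl pow. rewrite Rmult_1_r. auto. }
  assert (B1 : forall x, Rabs x <= a ->
            Rabs (Derive_n f 1 x - Derive_n f 1 0 - Derive_n f 2 0 * x)
              <= C * Rabs x ^ 2).
  { apply Rabs_le_pow_of_derive
      with (g' := fun x => Derive_n f 2 x - Derive_n f 2 0); auto; [ring|].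
    intros x Hx.
    apply is_derive_Rminus with (Derive_n f 2 x) (Derive_n f 2 0); auto.
    - apply is_derive_Rminus with (Derive_n f 2 x) 0; [apply D; auto | | ring].
      apply (is_derive_const (V := R_NormedModule)).
    - generalize (Derive_n f 2 0); intros c; auto_derive; auto; ring. }
  apply Rabs_le_pow_of_derive
    with (g' := fun x => Derive_n f 1 x - Derive_n f 1 0 - Derive_n f 2 0 * x);
    auto.
  - rewrite f0; field.
  - intros x Hx.
    apply is_derive_Rminus with
      (Derive_n f 1 x - Derive_n f 1 0) (Derive_n f 2 0 * x); auto.
    + apply is_derive_Rminus with (Derive_n f 1 x) (Derive_n f 1 0); auto.
      * apply (D 0%nat); auto with arith.
      * generalize (Derive_n f 1 0); intros c; auto_derive; auto; ring.
    + generalize (Derive_n f 2 0); intros c; auto_derive; auto; field.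
Qed.

(** * The complex exponential near 0 *)

Lemma exp_le_compat (x y : R) : x <= y -> exp x <= exp y.
Proof.
  intros [Hxy| ->]; [left; now apply exp_increasing | apply Rle_refl].
Qed.

Lemma Rabs_sin_le (b : R) : Rabs (sin b) <= Rabs b.
Proof.
  replace (Rabs b) with (1 * Rabs b ^ 1) by ring.
  apply (Rabs_le_pow_of_derive sin cos (Rabs b)); try lra.
  - apply sin_0.
  - intros; apply is_derive_sin.
  - intros x _. simpl. rewrite Rmult_1_r. apply Rabs_le, COS_bound.
Qed.

Lemma Rabs_cos_minus_1_le (b : R) : Rabs (cos b - 1) <= Rabs b.
Proof.
  replace (Rabs b) with (1 * Rabs b ^ 1) by ring.
  apply (Rabs_le_pow_of_derive (fun x => cos x - 1) (fun x => - sin x) (Rabs b));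
    try lra.
  - rewrite cos_0; ring.
  - intros; auto_derive; auto; ring.
  - intros x _. simpl. rewrite Rmult_1_r, Rabs_Ropp. apply Rabs_le, SIN_bound.
Qed.

(** Everything follows from [1 + x <= exp x] at [a] and [- a]; for [0 <= a], the inequality at [- a]
    is multiplied by [exp a]. *)
Lemma Rabs_exp_minus_1_le (a : R) : Rabs (exp a - 1) <= Rabs a * exp (Rabs a).
Proof.
  pose proof (exp_ineq1_le a) as Ha.
  destruct (Rle_dec 0 a) as [p|p].
  - rewrite (Rabs_pos_eq a), Rabs_pos_eq by lra.
    pose proof (exp_ineq1_le (- a)) as Hn.
    pose proof (exp_pos a).
    assert (exp a * exp (- a) = 1)
      by (rewrite <- exp_plus, Rplus_opp_r; apply exp_0).
    nra.
  - assert (exp a < 1) by (rewrite <- exp_0; apply exp_increasing; lra).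
    pose proof (exp_ineq1_le (- a)).
    rewrite !Rabs_left by lra. nra.
Qed.

Lemma Cmod_le_Rabs_plus (z : C) : Cmod z <= Rabs (Re z) + Rabs (Im z).
Proof.
  destruct z as [a b]. simpl.
  replace (a, b) with (Cplus (RtoC a) (Cmult Ci (RtoC b)))
    by (unfold Cplus, Cmult, Ci, RtoC; simpl; f_equal; ring).
  eapply Rle_trans; [apply Cmod_triangle|].
  rewrite Cmod_mult, Cmod_Ci, !Cmod_R. lra.
Qed.

Lemma Cexp_plus (z w : C) : Cexp (Cplus z w) = Cmult (Cexp z) (Cexp w).
Proof.
  destruct z as [a b], w as [c d].
  unfold Cexp, Cplus, Cmult; simpl.
  rewrite exp_plus, cos_plus, sin_plus.
  f_equal; ring.
Qed.

(** The 3 counts the pieces [exp a * (cos b - 1)], [exp a - 1] and [exp a * sin b], each at most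
    [q * exp q] in absolute value. *)
Lemma Cmod_Cexp_minus_1_le (a b q : R) :
  Rabs a <= q -> Rabs b <= q ->
  Cmod (Cminus (Cexp (a, b)) (RtoC 1)) <= 3 * q * exp q.
Proof.
  intros Ha Hb.
  eapply Rle_trans; [apply Cmod_le_Rabs_plus|].
  unfold Cexp, Cminus, Cplus, Copp, RtoC, Re, Im; simpl.
  replace (exp a * cos b + - (1)) with (exp a * (cos b - 1) + (exp a - 1)) by ring.
  replace (exp a * sin b + - 0) with (exp a * sin b) by ring.
  assert (Eq : exp a <= exp q /\ exp (Rabs a) <= exp q).
  { pose proof (Rle_abs a). split; apply exp_le_compat; lra. }
  destruct Eq as [E1 E2].
  pose proof (exp_pos a). pose proof (exp_pos (Rabs a)).
  pose proof (Rabs_pos a). pose proof (Rabs_pos b).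
  assert (T1 : Rabs (exp a * (cos b - 1)) <= exp q * q).
  { rewrite Rabs_mult, (Rabs_pos_eq (exp a)) by lra.
    pose proof (Rabs_cos_minus_1_le b).
    apply Rmult_le_compat; try lra. apply Rabs_pos. }
  assert (T2 : Rabs (exp a * sin b) <= exp q * q).
  { rewrite Rabs_mult, (Rabs_pos_eq (exp a)) by lra.
    pose proof (Rabs_sin_le b).
    apply Rmult_le_compat; try lra. apply Rabs_pos. }
  assert (T3 : Rabs (exp a - 1) <= exp q * q).
  { eapply Rle_trans; [apply Rabs_exp_minus_1_le|].
    rewrite Rmult_comm. apply Rmult_le_compat; lra. }
  pose proof (Rabs_triang (exp a * (cos b - 1)) (exp a - 1)).
  lra.
Qed.

(** * The weak characteristic function of Z_n in exponential form *)

Lemma tensor_pairing_repeat_Cexp (T : (R -> C) -> C) (f : R -> C) (z : C) (n : nat) :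
  T f = Cexp z ->
  tensor_pairing T (repeat f n) = Cexp (Cmult (RtoC (INR n)) z).
Proof.
  intros Hf. induction n as [|n IH].
  - unfold Cexp. simpl. rewrite !Rmult_0_l, Rminus_diag, Rplus_0_l, exp_0, cos_0, sin_0.
    unfold RtoC; f_equal; ring.
  - change (tensor_pairing T (repeat f (S n)))
      with (Cmult (T f) (tensor_pairing T (repeat f n))).
    rewrite IH, Hf, <- Cexp_plus, S_INR, RtoC_plus.
    f_equal. ring.
Qed.

(** Division by [Ci] exchanges the components up to sign, so a real first cumulant means that
    [Re (K u)] has derivative 0 at 0. *)
Lemma weak_cumulant_1 (K : R -> C) :
  weak_cumulant K 1
  = (Derive_n (fun u => Im (K u)) 1 0, - Derive_n (fun u => Re (K u)) 1 0).
Proof.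
  unfold weak_cumulant, CDerive_n, Cdiv, Cinv, Cmult, Ci, Cpow; simpl.
  f_equal; field.
Qed.

Lemma weak_cumulant_2 (K : R -> C) :
  weak_cumulant K 2
  = (- Derive_n (fun u => Re (K u)) 2 0, - Derive_n (fun u => Im (K u)) 2 0).
Proof.
  unfold weak_cumulant, CDerive_n, Cdiv, Cinv, Cmult, Ci, Cpow; simpl.
  f_equal; field.
Qed.

(** The centring contributes [- i n k1 u] to the exponent, and [t ^ 2 = n k2 u ^ 2] lets the
    Gaussian factor be split off; what is left is [n] times the quadratic Taylor remainder of [K] at
    [u]. *)
Lemma weak_cf_Z_eq (T : (R -> C) -> C) (phi K : R -> C) (n : nat) (t : R) :
  let k1 := Derive_n (fun u => Im (K u)) 1 0 in
  let k2 := - Derive_n (fun u => Re (K u)) 2 0 in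
  let u := t / sqrt (INR n * k2) in
  (1 <= n)%nat -> 0 < k2 ->
  Im (weak_cumulant K 1) = 0 ->
  Cexp (K u) = weak_cf T phi u ->
  weak_cf_Z T phi K n t =
    Cmult (RtoC (exp (- t ^ 2 / 2)))
      (Cexp (INR n * (Re (K u) + k2 * u ^ 2 / 2), INR n * (Im (K u) - k1 * u))).
Proof.
  intros k1 k2 u Hn Hk2 H1 HK.
  assert (Hn0 : 0 < INR n) by (apply lt_0_INR; lia).
  assert (Hs : 0 < sqrt (INR n * k2)) by (apply sqrt_lt_R0; nra).
  assert (Hs2 : sqrt (INR n * k2) * sqrt (INR n * k2) = INR n * k2)
    by (apply sqrt_sqrt; nra).
  assert (E1 : weak_cumulant K 1 = RtoC k1)
    by (rewrite weak_cumulant_1 in *; apply injective_projections; [reflexivity | exact H1]).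
  assert (E2 : Re (weak_cumulant K 2) = k2) by now rewrite weak_cumulant_2.
  unfold weak_cf_Z, weak_cf_sum. cbv zeta. rewrite E1, E2. fold u.
  rewrite (tensor_pairing_repeat_Cexp T _ (K u)) by now symmetry.
  replace (RtoC (exp (- t ^ 2 / 2))) with (Cexp (- t ^ 2 / 2, 0))
    by (unfold Cexp, RtoC; simpl; rewrite cos_0, sin_0; f_equal; ring).
  rewrite <- !Cexp_plus. f_equal.
  clearbody k1 k2.
  assert (Hu : t * (INR n * k1 / sqrt (INR n * k2)) = INR n * k1 * u)
    by (unfold u; field; lra).
  assert (Ht2 : t ^ 2 = INR n * k2 * u ^ 2).
  { rewrite <- Hs2 at 1. unfold u. field. lra. }
  rewrite <- RtoC_mult, <- RtoC_div, <- RtoC_mult, Hu, Ht2 by lra.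
  destruct (K u) as [a b]. unfold Cplus, Cmult, Copp, Ci, RtoC; simpl.
  f_equal; field.
Qed.

Theorem theorem8p5 (T0 c0 M : R) (hT0 : 0 < T0) (hc0 : 0 < c0) :
  exists A : R,
    forall (T : (R -> C) -> C) (Ker : (R -> C) -> Prop)
           (K : (R -> C) -> (R -> C)),
      tempered T ->
      (forall phi, Ker phi -> admissible T phi (K phi)) ->
      (* K phi is the weak cumulant generating function on an open interval
         containing [-T0/sqrt c0, T0/sqrt c0], where its third derivative
         exists *)
      (forall phi, Ker phi ->
         (exists rho, T0 / sqrt c0 < rho /\ is_weak_cgf T phi rho (K phi)) /\
         (forall u, Rabs u <= T0 / sqrt c0 -> ex_CDerive_upto (K phi) 3 u)) ->
      is_glb_Rbar
        (fun y => exists phi, Ker phi /\ y = Re (weak_cumulant (K phi) 2))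
        (Finite c0) ->
      is_lub_Rbar
        (fun y => exists phi u, Ker phi /\ Rabs u <= T0 / sqrt c0 /\
                    y = Cmod (CDerive_n (K phi) 3 u))
        (Finite M) ->
      forall n : nat, (1 <= n)%nat ->
        Rbar_le
          (Lub_Rbar
             (fun y => exists phi t, Ker phi /\ Rabs t <= T0 /\
                y = Cmod (Cminus (weak_cf_Z T phi (K phi) n t)
                                 (RtoC (exp (- t ^ 2 / 2))))))
          (Finite (A / sqrt (INR n))).

Proof.
  (* [q / sqrt n] will bound both components of the remaining exponent. *)
  set (q := M * (T0 / sqrt c0) ^ 3).
  exists (3 * q * exp q).
  intros T Ker K _ Hadm HK [Hinf _] [Hsup _] n Hn.
  apply Lub_Rbar_correct. intros y (phi & t & Hphi & Ht & ->).
  unfold Rbar_le.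
  destruct (Hadm phi Hphi) as [_ _ _ H1 H2 Hk2].
  destruct (HK phi Hphi) as [(rho & Hrho & HK0 & HKexp) Hex].
  assert (Hc2 : c0 <= Re (weak_cumulant (K phi) 2))
    by (apply (Hinf _ (ex_intro _ phi (conj Hphi eq_refl)))).
  assert (HM : forall u, Rabs u <= T0 / sqrt c0 ->
            Cmod (CDerive_n (K phi) 3 u) <= M).
  { intros u Hu. apply (Hsup (Cmod (CDerive_n (K phi) 3 u))).
    exists phi, u. auto. }
  clear Hinf Hsup Hadm HK.
  set (k2 := - Derive_n (fun u => Re (K phi u)) 2 0).
  assert (E2 : Re (weak_cumulant (K phi) 2) = k2) by now rewrite weak_cumulant_2.
  rewrite E2 in Hk2, Hc2.
  set (u := t / sqrt (INR n * k2)).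
  assert (Hn1 : 1 <= INR n) by (apply (le_INR 1); lia).
  assert (Hsn : 1 <= sqrt (INR n)) by (rewrite <- sqrt_1; apply sqrt_le_1_alt; lra).
  assert (Hsc : 0 < sqrt c0) by now apply sqrt_lt_R0.
  assert (Hsk : sqrt c0 <= sqrt k2) by now apply sqrt_le_1_alt.
  assert (Ha : 0 < T0 / sqrt c0) by now apply Rdiv_lt_0_compat.
  (* Uniformity over the kernels enters here, through [c0 <= k2]. *)
  assert (Hu : Rabs u <= T0 / sqrt c0 / sqrt (INR n)).
  { unfold u. rewrite sqrt_mult by lra.
    assert (Hss : 0 < sqrt (INR n) * sqrt k2) by (apply Rmult_lt_0_compat; lra).
    rewrite Rabs_div, (Rabs_pos_eq (_ * _)) by lra.
    replace (T0 / sqrt c0 / sqrt (INR n)) with (T0 * / (sqrt (INR n) * sqrt c0))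
      by (field; lra).
    apply Rmult_le_compat; auto.
    - apply Rabs_pos.
    - left. apply Rinv_0_lt_compat. nra.
    - apply Rinv_le_contravar; nra. }
  assert (Hua : Rabs u <= T0 / sqrt c0).
  { eapply Rle_trans; [apply Hu|]. apply Rle_div_l; nra. }
  assert (HM0 : 0 <= M).
  { eapply Rle_trans; [apply Cmod_ge_0 | apply (HM u Hua)]. }
  (* The rate: [n] times the cube of [1 / sqrt n] is [1 / sqrt n]. *)
  assert (Hr : INR n * (M * Rabs u ^ 3) <= q / sqrt (INR n)).
  { replace (q / sqrt (INR n))
      with (INR n * (M * (T0 / sqrt c0 / sqrt (INR n)) ^ 3)).
    - apply Rmult_le_compat_l; [lra|]. apply Rmult_le_compat_l; auto.
      apply pow_incr. split; [apply Rabs_pos | auto].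
    - unfold q. rewrite <- (sqrt_sqrt (INR n)) at 1 by lra. field. lra. }
  assert (HR : Rabs (Re (K phi u) + k2 * u ^ 2 / 2) <= M * Rabs u ^ 3).
  (* The real part has no linear term because the first cumulant is real. *)
  { assert (D1 : Derive_n (fun v => Re (K phi v)) 1 0 = 0).
    { rewrite weak_cumulant_1 in H1. simpl in H1 |- *. lra. }
    replace (Re (K phi u) + k2 * u ^ 2 / 2) with
      (Re (K phi u) - Derive_n (fun v => Re (K phi v)) 1 0 * u
        - Derive_n (fun v => Re (K phi v)) 2 0 * u ^ 2 / 2)
      by (rewrite D1; unfold k2; field).
    apply (taylor2_remainder (fun v => Re (K phi v)) (T0 / sqrt c0)); auto.
    - now rewrite HK0.
    - intros x Hx k Hk. now apply Hex.
    - intros x Hx. eapply Rle_trans; [|apply (HM x Hx)].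
      apply (re_le_Cmod (CDerive_n (K phi) 3 x)). }
  assert (HI : Rabs (Im (K phi u) - Derive_n (fun v => Im (K phi v)) 1 0 * u)
               <= M * Rabs u ^ 3).
  (* The imaginary part has no quadratic term because the second cumulant is real. *)
  { assert (D2 : Derive_n (fun v => Im (K phi v)) 2 0 = 0).
    { rewrite weak_cumulant_2 in H2. simpl in H2 |- *. lra. }
    replace (Im (K phi u) - Derive_n (fun v => Im (K phi v)) 1 0 * u) with
      (Im (K phi u) - Derive_n (fun v => Im (K phi v)) 1 0 * u
        - Derive_n (fun v => Im (K phi v)) 2 0 * u ^ 2 / 2)
      by (rewrite D2; field).
    apply (taylor2_remainder (fun v => Im (K phi v)) (T0 / sqrt c0)); auto.
    - now rewrite HK0.
    - intros x Hx k Hk. now apply Hex.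
    - intros x Hx. eapply Rle_trans; [|apply (HM x Hx)].
      eapply Rle_trans; [|apply Rmax_Cmod]. apply Rmax_r. }
  rewrite (weak_cf_Z_eq T phi (K phi) n t) by (auto; apply HKexp; fold k2 u; lra).
  fold k2 u.
  match goal with |- Cmod (Cminus (Cmult ?e ?z) _) <= _ =>
    replace (Cminus (Cmult e z) e) with (Cmult e (Cminus z (RtoC 1))) by ring end.
  rewrite Cmod_mult, Cmod_R, (Rabs_pos_eq (exp _)) by (left; apply exp_pos).
  assert (He : exp (- t ^ 2 / 2) <= 1)
    by (rewrite <- exp_0; apply exp_le_compat; nra).
  (* This allows [exp (q / sqrt n)] to be replaced by [exp q], so that the constant is free of
     [n]. *)
  assert (Hq : 0 <= q / sqrt (INR n) <= q).
  { assert (0 <= q) by (apply Rmult_le_pos; auto; apply pow_le; lra).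
    split; [apply Rdiv_le_0_compat; lra | apply Rle_div_l; nra]. }
  set (z := Cexp _).
  assert (Hz : Cmod (Cminus z (RtoC 1)) <= 3 * (q / sqrt (INR n)) * exp (q / sqrt (INR n))).
  { apply Cmod_Cexp_minus_1_le; rewrite Rabs_mult, (Rabs_pos_eq (INR n)) by lra;
      (eapply Rle_trans; [apply Rmult_le_compat_l; [lra | eassumption] | exact Hr]). }
  pose proof (Cmod_ge_0 (Cminus z (RtoC 1))).
  pose proof (exp_pos (- t ^ 2 / 2)).
  apply Rle_trans with (3 * (q / sqrt (INR n)) * exp (q / sqrt (INR n))); [nra|].
  replace (3 * q * exp q / sqrt (INR n)) with (3 * (q / sqrt (INR n)) * exp q)
    by (field; lra).
  apply Rmult_le_compat_l; [lra|]. now apply exp_le_compat.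
Qed.
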